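(* Every symplectic Novikov Lie algebra (SNLA) $(\mathfrak{g},\omega)$ is completely reducible. In particular, every nonzero SNLA admits a nonzero isotropic ideal.
   Context: A symplectic Lie algebra $(\mathfrak{g},\omega)$ is a finite-dimensional real Lie algebra $\mathfrak{g}$ with a skew-symmetric non-degenerate bilinear form $\omega$ such that $\omega([x,y],z)+\omega([y,z],x)+\omega([z,x],y)=0$ for all $x,y,z\in\mathfrak{g}$. The left-symmetric product associated with $(\mathfrak{g},\omega)$ is the bilinear product defined by $\omega(x.y,z)=-\omega(y,[x,z])$ for all $x,y,z$; it is known to be left-symmetric and to satisfy $x.y-y.x=[x,y]$. $(\mathfrak{g},\omega)$ is an SNLA if this product is Novikov, i.e. $(x.y).z=(x.z).y$ for all $x,y,z\in\mathfrak{g}$. An ideal $\mathfrak{h}$ of $\mathfrak{g}$ is isotropic if $\omega|_{\mathfrak{h}\times\mathfrak{h}}=0$, i.e. $\mathfrak{h}\subseteq\mathfrak{h}^\perp$, where $\perp$ denotes the $\omega$-orthogonal. For an isotropic ideal $\mathfrak{h}$, $\mathfrak{h}^\perp$ is a subalgebra containing $\mathfrak{h}$, and $\omega$ descends to a symplectic form $\overline{\omega}$ on the Lie algebra $\overline{\mathfrak{g}}=\mathfrak{h}^\perp/\mathfrak{h}$; $(\overline{\mathfrak{g}},\overline{\omega})$ is called the symplectic reduction of $(\mathfrak{g},\omega)$ with respect to $\mathfrak{h}$. A symplectic Lie algebra is completely reducible if it can be reduced, by a finite sequence of successive symplectic reductions, to the trivial (zero) symplectic Lie algebra. *)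

(* Defs.v *)
From HB Require Import structures.
From mathcomp Require Import all_boot all_order all_algebra.
From mathcomp Require Import generic_quotient ring_quotient sesquilinear.
From mathcomp Require Import reals.

Set Implicit Arguments.
Unset Strict Implicit.
Unset Printing Implicit Defensive.

Import GRing.Theory.
Local Open Scope ring_scope.
Local Open Scope quotient_scope.

(* MathComp provides V / U only as an additive group ([Quotient.quot], also
   printed [{ideal_quot U}]); this section makes it a finite-dimensional vector
   space with a linear projection. *)
Section VectQuotient.
Import VectorInternalTheory.
Variables (K : fieldType) (V : vectType K) (U : {vspace V}).
Local Notation Q := (@Quotient.quot V U).
Implicit Types (x y : V) (a b : Q).

Definition vquot_scale (c : K) : Q -> Q := lift_op1 Q (fun x => c *: x).

Lemma pi_vquot_eq x y : (\pi_Q x == \pi_Q y) = (x - y \in U).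
Proof. by rewrite -Quotient.idealrBE. Qed.

Lemma pi_vquot_scale c : {morph \pi_Q : x / c *: x >-> vquot_scale c x}.
Proof.
move=> x; unlock vquot_scale; apply/eqP.
by rewrite pi_vquot_eq -scalerBr memvZ // -pi_vquot_eq reprK eqxx.
Qed.

Lemma vquot_scalerA c d a :
  vquot_scale c (vquot_scale d a) = vquot_scale (c * d) a.
Proof. by rewrite -[a]reprK -!pi_vquot_scale scalerA. Qed.

Lemma vquot_scale1r : left_id 1 vquot_scale.
Proof. by move=> a; rewrite -[a]reprK -!pi_vquot_scale scale1r. Qed.

Lemma vquot_scalerDr : right_distributive vquot_scale +%R.
Proof.
move=> c a b; rewrite -[a]reprK -[b]reprK -!pi_vquot_scale.
by rewrite -!(raddfD \pi_Q) -!pi_vquot_scale scalerDr.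
Qed.

Lemma vquot_scalerDl a : {morph vquot_scale^~ a : c d / c + d}.
Proof.
by move=> c d; rewrite -[a]reprK -!pi_vquot_scale scalerDl raddfD.
Qed.

HB.instance Definition _ := GRing.Zmodule_isLmodule.Build K Q
  vquot_scalerA vquot_scale1r vquot_scalerDr vquot_scalerDl.

Lemma pi_vquot_is_scalable : scalable (\pi_Q : V -> Q).
Proof. by move=> c x; rewrite pi_vquot_scale. Qed.

HB.instance Definition _ :=
  GRing.isScalable.Build K V Q *:%R (\pi_Q : V -> Q) pi_vquot_is_scalable.

Lemma pi_vquot_eq0 x : (\pi_Q x == 0) = (x \in U).
Proof. by rewrite -(raddf0 \pi_Q) pi_vquot_eq subr0. Qed.

Lemma vquot_vect_iso : Vector.axiom (\dim U^C) Q.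
Proof.
pose W := subvs_of U^C.
pose p x : W := vsproj U^C (daddv_pi U^C U x).
have capCU : (U^C :&: U = 0)%VS by rewrite capvC capv_compl.
have pE x : vsval (p x) = daddv_pi U^C U x by rewrite vsprojK // memv_pi.
have pi_pE x : \pi_Q (vsval (p x)) = \pi_Q x.
  apply/eqP; rewrite pi_vquot_eq pE.
  have xE : daddv_pi U^C U x + daddv_pi U U^C x = x.
    by apply: daddv_pi_add; rewrite // addvC addv_complf memvf.
  by rewrite -{2}xE opprD addrA subrr add0r memvN memv_pi.
have p_id (w : W) : p (vsval w) = w.
  by apply: subvs_inj; rewrite pE daddv_pi_id ?subvsP.
have p_lin : linear p by move=> c x y; rewrite /p !linearP.
have pB x y : p (x - y) = p x - p y by rewrite /p !linearB.
have p0 x : x \in U -> p x = 0.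
  move=> xU; have : vsval (p x) \in (U^C :&: U)%VS.
    by rewrite memv_cap subvsP /= -pi_vquot_eq0 pi_pE pi_vquot_eq0.
  by rewrite capCU memv0 => /eqP px0; apply: subvs_inj.
have p_eq x y : \pi_Q x = \pi_Q y -> p x = p y.
  move/eqP; rewrite pi_vquot_eq => /p0 pxy0.
  by apply/eqP; rewrite -subr_eq0 -pB pxy0.
exists (fun a => v2r (p (repr a))).
  move=> c a b; have -> : p (repr (c *: a + b)) = c *: p (repr a) + p (repr b).
    by rewrite -p_lin; apply: p_eq; rewrite linearP /= !reprK.
  exact: (linearP (@v2r _ W)).
exists (fun r => \pi_Q (vsval (r2v r : W))) => [a | r].
  by rewrite v2rK pi_pE reprK.
apply: (canLR (@r2vK _ W)); rewrite -[RHS]p_id.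
by apply: p_eq; rewrite reprK.
Qed.

HB.instance Definition _ := Lmodule_hasFinDim.Build K Q vquot_vect_iso.

Variable T : Type.

Definition vquot_lift2 (f : V -> V -> T) (a b : Q) : T := f (repr a) (repr b).

Lemma vquot_lift2E (f : V -> V -> T) :
  (forall x x' y, x - x' \in U -> f x y = f x' y) ->
  (forall x y y', y - y' \in U -> f x y = f x y') ->
  forall x y, vquot_lift2 f (\pi_Q x) (\pi_Q y) = f x y.
Proof.
move=> fl fr x y; rewrite /vquot_lift2.
by rewrite (fl _ x) ?(fr _ _ y) // -pi_vquot_eq reprK eqxx.
Qed.

End VectQuotient.

Section LieAlgebras.
Variable K : fieldType.

Record lieAlgebra := LieAlgebra {
  lie_sort :> vectType K;
  lie_br : {bilinear lie_sort -> lie_sort -> lie_sort};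
  lie_alt : forall x, lie_br x x = 0;
  lie_jacobi : forall x y z,
    lie_br x (lie_br y z) + lie_br y (lie_br z x) + lie_br z (lie_br x y) = 0
}.

Arguments lie_br {_}.

Implicit Types g : lieAlgebra.

Definition is_subalgebra g (W : {vspace g}) : Prop :=
  {in W &, forall x y : g, lie_br x y \in W}.

Definition is_ideal g (h : {vspace g}) : Prop :=
  forall x y : g, y \in h -> lie_br x y \in h.

Lemma lie_brC g (x y : g) : lie_br x y = - lie_br y x.
Proof.
apply/eqP; rewrite -addr_eq0; apply/eqP.
have := lie_alt (x + y).
by rewrite linearDl !linearDr /= !lie_alt add0r addr0.
Qed.

Section SubLie.
Variables (g : lieAlgebra) (W : {vspace g}) (Wsub : is_subalgebra W).
Local Notation S := (subvs_of W).

Definition sub_br (u v : S) : S := vsproj W (lie_br (vsval u) (vsval v)).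

Fact sub_br_bilinear : bilinear_for *:%R *:%R sub_br.
Proof.
split=> u c v w; rewrite /sub_br.
  by rewrite linearP linearPl linearP.
by rewrite !linearP.
Qed.

HB.instance Definition _ :=
  bilinear_isBilinear.Build K S S S *:%R *:%R sub_br sub_br_bilinear.

Lemma sub_brE u v : vsval (sub_br u v) = lie_br (vsval u) (vsval v).
Proof. by rewrite vsprojK // Wsub // subvsP. Qed.

Fact sub_lie_alt u : sub_br u u = 0.
Proof. by rewrite /sub_br lie_alt linear0. Qed.

Fact sub_lie_jacobi u v w :
  sub_br u (sub_br v w) + sub_br v (sub_br w u) + sub_br w (sub_br u v) = 0.
Proof. by apply: val_inj; rewrite /= !sub_brE lie_jacobi. Qed.

Definition sub_lie : lieAlgebra := LieAlgebra sub_lie_alt sub_lie_jacobi.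

Lemma sub_lie_brE (u v : sub_lie) :
  vsval (lie_br u v) = lie_br (vsval u) (vsval v).
Proof. exact: sub_brE. Qed.

End SubLie.

Section QuotLie.
Variables (g : lieAlgebra) (h : {vspace g}) (hI : is_ideal h).
Local Notation Q := (@Quotient.quot g h).

(* [hI] only serves to attach the bilinear structure to [quot_br hI]. *)
Definition quot_br of is_ideal h : Q -> Q -> Q :=
  vquot_lift2 (fun x y => \pi_Q (lie_br x y)).

Lemma quot_brE x y : quot_br hI (\pi x) (\pi y) = \pi_Q (lie_br x y).
Proof.
apply: vquot_lift2E => {x y} [x x' y xx' | x y y' yy']; apply/eqP;
  rewrite pi_vquot_eq.
  by rewrite -linearBl lie_brC memvN hI.
by rewrite -linearBr hI.
Qed.

Fact quot_br_bilinear : bilinear_for *:%R *:%R (quot_br hI).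
Proof.
split=> a c b d; rewrite -[a]reprK -[b]reprK -[d]reprK -linearP !quot_brE.
  by rewrite linearPl linearP.
by rewrite !linearP.
Qed.

HB.instance Definition _ := bilinear_isBilinear.Build K Q Q Q *:%R *:%R
  (quot_br hI) quot_br_bilinear.

Fact quot_lie_alt a : quot_br hI a a = 0.
Proof. by rewrite -[a]reprK quot_brE lie_alt linear0. Qed.

Fact quot_lie_jacobi a b c :
  quot_br hI a (quot_br hI b c) + quot_br hI b (quot_br hI c a)
    + quot_br hI c (quot_br hI a b) = 0.
Proof.
by rewrite -[a]reprK -[b]reprK -[c]reprK !quot_brE -!linearD lie_jacobi linear0.
Qed.

Definition quot_lie : lieAlgebra := LieAlgebra quot_lie_alt quot_lie_jacobi.

Lemma quot_lie_brE x y :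
  lie_br (\pi_Q x : quot_lie) (\pi_Q y : quot_lie) = \pi_Q (lie_br x y).
Proof. exact: quot_brE. Qed.

End QuotLie.

Record symplecticLieAlgebra := SymplecticLieAlgebra {
  sympl_lie :> lieAlgebra;
  omega : {skew_symmetric sympl_lie};
  omega_nondeg : nondegenerate omega;
  omega_closed : forall x y z,
    omega (lie_br x y) z + omega (lie_br y z) x + omega (lie_br z x) y = 0
}.

Section Symplectic.
Variable g : symplecticLieAlgebra.
Local Notation "''w' ( x , y )" := (omega g x y) (format "''w' ( x ,  y )").
Implicit Types (x y z : g) (h : {vspace g}).

Lemma omegaC x y : 'w(x, y) = - 'w(y, x).
Proof. by rewrite hermC expr1 mulN1r. Qed.

Lemma omega_inj x : (forall y, 'w(x, y) = 0) -> x = 0.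
Proof.
move=> x0; apply/eqP; rewrite -memv0 -(eqP (omega_nondeg g)).
by apply/mem_orthovP => y _; apply: x0.
Qed.

Definition flat_at x : 'Hom(g, K^o) := linfun (omega g x : g -> K^o).
Definition flat : 'Hom(g, 'Hom(g, K^o)) := linfun flat_at.

Definition ad x : 'End(g) := linfun (lie_br x).

(* flat (x.y) = - (flat y \o ad x), i.e. w(x.y, z) = - w(y, [x, z]); the
   invertibility of [flat] and the characterization of the product are
   [flat_surj], [lsprodE] and [lsprod_unique]. *)
Definition lsprod x y : g := (flat^-1)%VF (- (flat y \o ad x))%VF.

Lemma flatE x y : flat x y = 'w(x, y).
Proof.
have flat_lin : linear flat_at.
  move=> c u v; apply/lfunP => z.
  by rewrite add_lfunE scale_lfunE !lfunE /= linearPl.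
pose fL := GRing.isLinear.Build _ _ _ _ flat_at flat_lin.
pose fl : {linear g -> 'Hom(g, K^o)} := HB.pack flat_at fL.
by rewrite /flat (lfunE fl) /= lfunE.
Qed.

Lemma flat_surj (f : 'Hom(g, K^o)) : flat (flat^-1%VF f) = f.
Proof.
apply: limg_lfunVK.
suff -> : limg flat = fullv by rewrite memvf.
have ker0 : lker flat = 0%VS.
  apply/eqP; rewrite -subv0; apply/subvP => x; rewrite memv_ker => /eqP x0.
  by rewrite memv0; apply/eqP/omega_inj => y; rewrite -flatE x0 zero_lfunE.
apply/eqP; rewrite eqEdim subvf /= !dimvf.
rewrite limg_dim_eq ?dimvf; last by rewrite ker0 capv0.
by rewrite /dim /= muln1.
Qed.

Lemma lsprodE x y z : 'w(lsprod x y, z) = - 'w(y, lie_br x z).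
Proof.
by rewrite -flatE flat_surj opp_lfunE comp_lfunE flatE lfunE.
Qed.

Lemma lsprod_unique (p : g -> g -> g) :
  (forall x y z, 'w(p x y, z) = - 'w(y, lie_br x z)) ->
  forall x y, p x y = lsprod x y.
Proof.
move=> pE x y; apply/eqP; rewrite -subr_eq0; apply/eqP/omega_inj => z.
by rewrite linearBl /= pE lsprodE subrr.
Qed.

Definition is_SNLA : Prop :=
  forall x y z, lsprod (lsprod x y) z = lsprod (lsprod x z) y.

Definition is_isotropic h : Prop := {in h &, forall x y, 'w(x, y) = 0}.

Definition isotropic_ideal h : Prop := is_ideal h /\ is_isotropic h.

Local Notation orth h := (orthov (omega g) h).

Lemma orth_orth h : orth (orth h) = h.
Proof.
apply: subv_anti; apply/andP; split; last first.
  apply/subvP => x xh; apply/mem_orthovP => y /mem_orthovP yh.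
  by rewrite omegaC yh ?oppr0.
apply/subvP => x /mem_orthovP xhh.
pose r : 'End(g) := (\1 - projv h)%VF.
have rE y : r y = y - projv h y by rewrite !lfun_simp.
suff: r x = 0.
  by rewrite rE => /eqP; rewrite subr_eq0 => /eqP ->; apply: memv_proj.
apply: omega_inj => z.
pose f : 'Hom(g, K^o) := (flat z \o r)%VF.
have fE y : f y = 'w(z, r y) by rewrite comp_lfunE flatE.
rewrite omegaC -fE -(flat_surj f) flatE omegaC opprK.
rewrite xhh //; apply/mem_orthovP => y yh.
by rewrite -flatE flat_surj fE rE projv_id // subrr linear0r.
Qed.

Section Reduction.
Variables (h : {vspace g}) (hI : isotropic_ideal h).
Local Notation hp := (orth h).

Lemma isotropic_sub : (h <= hp)%VS.
Proof.
by apply/subvP => x xh; apply/mem_orthovP => y yh; apply: (proj2 hI).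
Qed.

Fact orth_subalgebra : is_subalgebra hp.
Proof.
move=> x y /mem_orthovP xh /mem_orthovP yh; apply/mem_orthovP => z zh.
have := omega_closed x y z.
rewrite [lie_br z x]lie_brC linearNl /=.
rewrite ['w(lie_br y z, x)]omegaC ['w(lie_br x z, y)]omegaC xh ?yh.
- by rewrite !oppr0 !addr0.
- exact: (proj1 hI).
- exact: (proj1 hI).
Qed.

(* h as a subspace of its orthogonal *)
Definition in_orth : {vspace sub_lie orth_subalgebra} :=
  (linfun (@vsval _ _ hp) @^-1: h)%VS.

Lemma mem_in_orth u : (u \in in_orth) = (vsval u \in h).
Proof. by rewrite -memv_preim lfunE. Qed.

Fact in_orth_ideal : is_ideal in_orth.
Proof.
move=> u v; rewrite !mem_in_orth => vh.
by rewrite (sub_brE orth_subalgebra); apply: (proj1 hI).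
Qed.

Definition reduction_lie : lieAlgebra := quot_lie in_orth_ideal.

Definition reduction_form : reduction_lie -> reduction_lie -> K :=
  vquot_lift2 (fun u v : sub_lie orth_subalgebra => 'w(vsval u, vsval v)).

Lemma reduction_formE u v :
  reduction_form (\pi u) (\pi v) = 'w(vsval u, vsval v).
Proof.
have w0 (a b : subvs_of hp) : a \in in_orth -> 'w(vsval b, vsval a) = 0.
  by rewrite mem_in_orth => ah; have /mem_orthovP := subvsP b; apply.
apply: vquot_lift2E => {u v} [u u' v uu' | u v v' vv'].
  rewrite omegaC ['w(vsval u', _)]omegaC; congr (- _); apply/eqP.
  rewrite -subr_eq0 -(linearBr (omega g)) -(linearB (@vsval _ _ hp)).
  by apply/eqP; apply: w0.
apply/eqP; rewrite -subr_eq0 -(linearBr (omega g)).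
by rewrite -(linearB (@vsval _ _ hp)); apply/eqP; apply: w0.
Qed.

Fact reduction_form_bilinear :
  bilinear_for *%R (idfun \; *%R) reduction_form.
Proof.
split=> a c b d; rewrite -[a]reprK -[b]reprK -[d]reprK -linearP
  !reduction_formE linearP.
  by rewrite linearPl.
by [].
Qed.

Fact reduction_form_skew a b :
  reduction_form a b = (-1) ^+ true * idfun (reduction_form b a).
Proof.
by rewrite -[a]reprK -[b]reprK !reduction_formE omegaC expr1 mulN1r.
Qed.

HB.instance Definition _ := bilinear_isBilinear.Build K
  reduction_lie reduction_lie K *%R (idfun \; *%R) reduction_form
  reduction_form_bilinear.
HB.instance Definition _ := isHermitianSesquilinear.Build K
  reduction_lie true idfun reduction_form reduction_form_skew.

Fact reduction_form_nondeg :
  nondegenerate (reduction_form : {skew_symmetric reduction_lie}).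
Proof.
rewrite /nondegenerate -subv0; apply/subvP => a /mem_orthovP a0.
rewrite memv0; move: a a0; elim/quotW => u a0.
rewrite pi_vquot_eq0 mem_in_orth.
suff: vsval u \in orth hp by rewrite orth_orth.
apply/mem_orthovP => y yhp.
have := reduction_formE u (vsproj hp y); rewrite vsprojK // => <-.
exact: a0 (memvf _).
Qed.

Fact reduction_form_closed (a b c : reduction_lie) :
  reduction_form (lie_br a b) c + reduction_form (lie_br b c) a
    + reduction_form (lie_br c a) b = 0.
Proof.
elim/quotW: a => u; elim/quotW: b => v; elim/quotW: c => w.
rewrite !quot_lie_brE !reduction_formE !sub_lie_brE.
exact: omega_closed.
Qed.

(* The Lie algebra h^perp / h with the form induced by w; see [quot_lie_brE],
   [sub_lie_brE] and [reduction_formE] for its operations on classes. *)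
Definition reduction : symplecticLieAlgebra :=
  @SymplecticLieAlgebra reduction_lie reduction_form
    reduction_form_nondeg reduction_form_closed.

End Reduction.
End Symplectic.

(* h = 0 is allowed as a step: it gives back g up to isomorphism. *)
Inductive completely_reducible : symplecticLieAlgebra -> Prop :=
| completely_reducible_zero (g : symplecticLieAlgebra) :
    {:g}%VS = 0%VS -> completely_reducible g
| completely_reducible_step (g : symplecticLieAlgebra) (h : {vspace g})
      (hI : isotropic_ideal h) :
    completely_reducible (reduction hI) -> completely_reducible g.

End LieAlgebras.

(* Main.v *)
(** The product of an SNLA is associative.  Moving one factor across [omega] in
    the Novikov identity gives [xz, t] = [x, tz]; together with left-symmetry
    this reads 2 ((tx)z - t(xz)) = 0.  Hence t(xz) = (tx)z = (tz)x = t(zx), that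
    is t.[x, z] = 0, which by definition of the product means that [g, g] is
    isotropic.  Every subspace containing [g, g] is an ideal, so a Lagrangian
    subspace U containing [g, g] is an isotropic ideal with reduction
    U^perp / U = 0, and U is nonzero as soon as g is. *)

Require Import Defs.
From HB Require Import structures.
From mathcomp Require Import all_boot all_order all_algebra.
From mathcomp Require Import generic_quotient sesquilinear.
From mathcomp Require Import boolp reals.

Set Implicit Arguments.
Unset Strict Implicit.
Unset Printing Implicit Defensive.

Import GRing.Theory Num.Theory.
Local Open Scope ring_scope.

Section SymplecticNovikov.
Variables (K : fieldType) (g : symplecticLieAlgebra K).
Hypothesis two_neq0 : (2 : K) != 0.

Local Notation w := (omega g).
Local Notation br := (@lie_br K g).
Local Notation "x ** y" := (@lsprod K g x y) (at level 40, left associativity).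
Implicit Types (x y z t : g) (U : {vspace g}).

Lemma omega_eq x y : (forall t, w x t = w y t) -> x = y.
Proof.
move=> xy; apply/eqP; rewrite -subr_eq0; apply/eqP/omega_inj => t.
by rewrite linearBl /= xy subrr.
Qed.

(** Skew-symmetry only yields [w x x = - w x x], so 2 has to be cancelled. *)
Lemma omega_alt x : w x x = 0.
Proof.
apply/eqP; have /eqP := omegaC x x.
by rewrite -addr_eq0 -mulr2n -mulr_natl mulf_eq0 (negPf two_neq0).
Qed.

Lemma lsprod_bracket x y : x ** y - y ** x = br x y.
Proof.
apply: omega_eq => t; rewrite linearBl /= !lsprodE.
have /eqP := omega_closed x y t.
rewrite -addrA addr_eq0 => /eqP ->.
rewrite (omegaC (br y t)) (omegaC (br t x)) (lie_brC t x) linearNr /=.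
by rewrite !opprD !opprK addrC.
Qed.

Lemma lsprodBr x y z : x ** (y - z) = x ** y - x ** z.
Proof.
by apply: omega_eq => t; rewrite linearBl /= !lsprodE linearBl opprD.
Qed.

(** Both sides equal [- w x (br y z)], because the form and the bracket are both skew. *)
Lemma lsprod_selfadjoint x y z : w (y ** x) z = w y (z ** x).
Proof.
by rewrite lsprodE omegaC lie_brC linearNl opprK (omegaC y) lsprodE opprK omegaC.
Qed.

Lemma lsprodBl x y z : (x - y) ** z = x ** z - y ** z.
Proof.
apply: omega_eq => t.
by rewrite linearBl /= !lsprodE linearBl linearBr opprB opprK addrC.
Qed.

(** Left multiplication by [x] is minus the [w]-adjoint of [ad x]; by the Jacobi identity these maps
    form the dual of the adjoint representation. *)
Lemma lsprod_left_symmetric x y z :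
  br x y ** z = x ** (y ** z) - y ** (x ** z).
Proof.
apply: omega_eq => t; rewrite linearBl /= !lsprodE !opprK -linearBr -linearN.
congr (w z _); apply/eqP.
have /eqP := lie_jacobi x y t.
rewrite addrC addr_eq0 (lie_brC t) => /eqP ->.
by rewrite (lie_brC t x) linearNr opprB addrC.
Qed.

Lemma isotropic_add_line U x :
  is_isotropic U -> x \in orthov w U -> is_isotropic (U + <[x]>)%VS.
Proof.
move=> Uiso /mem_orthovP xU p q /memv_addP[u uU [_ /vlineP[a ->] ->]].
case/memv_addP=> [v vU [_ /vlineP[b ->] ->]].
rewrite linearDl !linearDr /= !linearZl_LR !linearZr_LR /=.
by rewrite Uiso // xU // omegaC xU // omega_alt oppr0 !mulr0 !addr0.
Qed.

Section SNLA.
Hypothesis gN : is_SNLA g.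

Lemma snla_bracket_lsprod x z t : br (x ** z) t = br x (t ** z).
Proof.
apply: omega_eq => y; rewrite omegaC [RHS]omegaC -!lsprodE gN.
by rewrite lsprod_selfadjoint lsprodE.
Qed.

Lemma snla_lsprodA x y z : (x ** y) ** z = x ** (y ** z).
Proof.
set p := _ ** z; set q := x ** _.
have symE : y ** x ** z - p = y ** (x ** z) - q.
  by rewrite -lsprodBl lsprod_bracket lsprod_left_symmetric.
(* By the Novikov identity the two sides are [br (y ** z) x] and [br y (x ** z)]. *)
have brE : y ** x ** z - q = y ** (x ** z) - p.
  rewrite gN /p [x ** y ** z]gN !lsprod_bracket.
  exact: snla_bracket_lsprod.
(* [symE] and [brE] differ by exchanging [p] and [q]; their difference gives this. *)
have pq : p - q = - (p - q).
  rewrite opprB; apply: (addrI (y ** x ** z - p)).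
  by rewrite addrA subrK brE symE addrA subrK.
apply/eqP; rewrite -subr_eq0; move/eqP: pq.
by rewrite -addr_eq0 -mulr2n -scaler_nat scaler_eq0 (negPf two_neq0).
Qed.

Lemma snla_lsprod_bracket x y z : x ** br y z = 0.
Proof.
by rewrite -lsprod_bracket lsprodBr -!snla_lsprodA gN subrr.
Qed.

Lemma snla_derived_isotropic x y z t : w (br x y) (br z t) = 0.
Proof.
by apply/eqP; rewrite -oppr_eq0 -lsprodE snla_lsprod_bracket linear0l.
Qed.

(* Isotropic subspaces orthogonal to [g, g] are the right ones to enlarge: 0 is
   one of them, and a maximal one absorbs every bracket. *)
Lemma snla_lagrangian_ideal :
  exists U : {vspace g}, isotropic_ideal U /\ (orthov w U <= U)%VS.
Proof.
pose P U := is_isotropic U /\ forall u x y, u \in U -> w u (br x y) = 0.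
suff [U [[Uiso Uder] Umax]] :
    exists U, P U /\ forall U', P U' -> (U <= U')%VS -> (U' <= U)%VS.
  (* Adjoining such a [z] to [U] preserves [P], so maximality puts [z] in [U]. *)
  have absorb z : z \in orthov w U -> (forall x y, w z (br x y) = 0) -> z \in U.
    move=> zU zder; have /Umax : P (U + <[z]>)%VS.
      split=> [|_ x y /memv_addP[u uU [_ /vlineP[a ->] ->]]].
        exact: isotropic_add_line.
      by rewrite linearDl linearZl_LR /= Uder // zder mulr0 addr0.
    move/(_ (addvSl _ _))/subvP; apply.
    by rewrite (subvP (addvSr U _)) ?memv_line.
  have brU x y : br x y \in U.
    apply: absorb => [|z t]; last exact: snla_derived_isotropic.
    by apply/mem_orthovP => u uU; rewrite omegaC Uder ?oppr0.
  exists U; split; first by split=> // x y _.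
  (* A vector orthogonal to [U] is orthogonal to all brackets, as these lie in [U]. *)
  apply/subvP => z zU; apply: absorb => // x y.
  by move/mem_orthovP: zU; apply.
have P0 : P 0%VS.
  split=> [x y|u x y]; rewrite memv0 => /eqP ->; last by rewrite linear0l.
  by rewrite linear0l.
(* Dimensions are bounded by that of [g], and a member of [P] of largest dimension is maximal for
   inclusion. *)
pose has_dim n := `[< exists U, P U /\ \dim U = n >].
have ex_dim : exists n, has_dim n.
  by exists 0%N; apply/asboolP; exists 0%VS; rewrite dimv0.
have le_dim n : has_dim n -> (n <= \dim {:g})%N.
  by case/asboolP=> U [_ <-]; rewrite dimvS ?subvf.
have [n /asboolP[U [PU <-]] max_n] := ex_maxnP ex_dim le_dim.
exists U; split=> // U' PU' UU'; suff /eqP -> : U == U' by [].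
by rewrite eqEdim UU' max_n //; apply/asboolP; exists U'.
Qed.

End SNLA.
End SymplecticNovikov.

Lemma completely_reducible_lagrangian (K : fieldType)
    (g : symplecticLieAlgebra K) (U : {vspace g}) :
  isotropic_ideal U -> (orthov (omega g) U <= U)%VS -> completely_reducible g.
Proof.
move=> UI /subvP orthU; apply: (@completely_reducible_step _ g U UI).
apply: completely_reducible_zero; apply/eqP; rewrite -subv0.
apply/subvP; elim/quotW => u _; rewrite memv0 pi_vquot_eq0 mem_in_orth.
exact/orthU/subvsP.
Qed.

Theorem corollary5 (R : realType) :
  (forall g : symplecticLieAlgebra R, is_SNLA g -> completely_reducible g) /\
  (forall g : symplecticLieAlgebra R, is_SNLA g ->
     {:g}%VS <> 0%VS ->
     exists h : {vspace g}, h <> 0%VS /\ isotropic_ideal h).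
Proof.
have two_neq0 : (2 : R) != 0 by rewrite pnatr_eq0.
split=> g gN; have [U [UI orthU]] := snla_lagrangian_ideal two_neq0 gN.
  exact: completely_reducible_lagrangian UI orthU.
(* If [U] were zero, its orthogonal would be all of [g] and yet lie in [U]. *)
move=> g0; exists U; split=> // U0; apply: g0; apply/eqP; rewrite -subv0 -U0.
apply: subv_trans orthU; apply/subvP => x _; apply/mem_orthovP => y.
by rewrite U0 memv0 => /eqP ->; rewrite linear0r.
Qed.
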